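(* Let $(X,d_X,\mu_X)$ and $(Y,d_Y,\mu_Y)$ be (compact) metric measure spaces, and let $\theta_N^X$ and $\theta_N^Y$ denote the associated distributions on $N\times N$ distance matrices. Then: (1) $\limsup_{N\to\infty} d_P(\theta_N^X,\theta_N^Y;d_\pi)\leq 2\,d_{GHP}(X,Y)$. (2) If $\liminf_{N\to\infty} d_P(\theta_N^X,\theta_N^Y;d_\pi)<\epsilon<1$, then $d_{GHP}(X,Y)<\epsilon$.
   Context: A metric measure space is a triple $(X,d,\mu)$ with $(X,d)$ a compact metric space and $\mu$ a Borel probability measure on $X$. Prokhorov distance: let $\mu_1,\mu_2$ be Borel probability measures on a (pseudo-)metric space $(Z,d_Z)$. For a probability measure $\theta$ on $Z\times Z$ with marginals $\mu_1,\mu_2$ put $\Delta(\theta;d_Z)=\inf\{r>0:\theta(\{(z_1,z_2): d_Z(z_1,z_2)\le r\})\ge 1-r\}$, and let $d_P(\mu_1,\mu_2;d_Z)=\inf_\theta \Delta(\theta;d_Z)$ over all such $\theta$. Gromov-Hausdorff-Prokhorov distance: $d_{GHP}(X_1,X_2)=\inf d_P(\iota_{1*}\mu_1,\iota_{2*}\mu_2;d_Z)$, the infimum being over all compact metric spaces $Z$ and isometric (distance-preserving) embeddings $\iota_i:X_i\to Z$, $i=1,2$. Matrices: $M(N)$ is the space of real symmetric $N\times N$ matrices. For $A=(a_{ij}),B=(b_{ij})\in M(N)$, let $d_M(A,B)=\inf\{\rho>0:\exists\lambda\subset\{1,\dots,N\},\ |\lambda|<N\rho,\ |a_{ij}-b_{ij}|<\rho\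 \forall i,j\notin\lambda\}$ (a pseudo-metric). The symmetric group $S_N$ acts on $M(N)$ by simultaneous permutation of rows and columns, and $d_\pi(A,B)=\min\{d_M(A,\pi B):\pi\in S_N\}$. $\mathbb{D}(N)\subset M(N)$ is the set of distance matrices (symmetric, non-negative entries, zero diagonal, $a_{ij}\le a_{ik}+a_{kj}$ for all $i,j,k$), with the restrictions of these pseudo-metrics; measures on $M(N)$, $\mathbb{D}(N)$ are Borel for the usual topology of matrices. For a metric measure space $(X,d,\mu)$ and $N\in\mathbb{N}$, $\theta_N^X$ is the distribution on $\mathbb{D}(N)$ of the random matrix $M_N^X=(d(x_i,x_j))_{1\le i,j\le N}$, where $x_1,\dots,x_N$ are sampled independently from $X$ according to $\mu$. *)

(* Defs.v *)
From HB Require Import structures.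
From mathcomp Require Import all_boot all_order all_algebra all_fingroup.
From mathcomp Require Import all_classical all_reals all_analysis.
From mathcomp Require Import measurable_realfun lra.

Set Implicit Arguments.
Unset Strict Implicit.
Unset Printing Implicit Defensive.

Import Order.TTheory GRing.Theory Num.Theory.
Import numFieldNormedType.Exports.

Local Open Scope classical_set_scope.
Local Open Scope ring_scope.

(* Measurable types of MathComp-Analysis are pointed.  The chosen point plays
   no role below, and a space carrying a probability measure is nonempty. *)
#[short(type="pmetricType")]
HB.structure Definition PointedMetric (K : numDomainType) :=
  {M of Metric K M & Pointed M}.

Notation borel T := (g_sigma_algebraType (@open T)).

(* On the spaces used below (compact metric spaces and spaces of matrices),
   which are second countable, the product sigma-algebra carried by [T * T]
   is the Borel sigma-algebra of the product topology. *)
Section Prokhorov.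
Context d (T : measurableType d) (R : realType).
Local Open Scope ereal_scope.

Definition coupling (P1 P2 : probability T R) : set (probability (T * T)%type R) :=
  [set theta | forall A : set T, measurable A ->
     theta (A `*` setT) = P1 A /\ theta (setT `*` A) = P2 A].

Definition Delta (theta : set (T * T) -> \bar R) (dist : T -> T -> R) : \bar R :=
  ereal_inf [set r%:E | r in
    [set r : R | (0 < r)%R /\
       (1 - r)%:E <= theta [set z | (dist z.1 z.2 <= r)%R]]].

Definition dP (P1 P2 : probability T R) (dist : T -> T -> R) : \bar R :=
  ereal_inf [set Delta theta dist | theta in coupling P1 P2].

End Prokhorov.

(* [distribution mu f] is the push-forward of [mu] by [f]. *)
Section IIDSample.
Context d (T : measurableType d) (R : realType).

Definition tcons n (x : T * n.-tuple T) : n.+1.-tuple T := [tuple of x.1 :: x.2].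

Lemma measurable_tcons n : measurable_fun [set: T * n.-tuple T] (@tcons n).
Proof. exact: measurable_cons. Qed.

HB.instance Definition _ n :=
  isMeasurableFun.Build _ _ (T * n.-tuple T)%type (n.+1.-tuple T) (@tcons n)
    (@measurable_tcons n).

(* The law of n independent points with law mu, i.e. the product measure
   mu^n on n-tuples; see iid_rectangle. *)
Fixpoint iid (mu : probability T R) (n : nat) : probability (n.-tuple T) R :=
  match n with
  | 0 => @dirac _ (0.-tuple T) [tuple] R
  | n'.+1 => distribution (mu \x iid mu n')%E (@tcons n')
  end.

Lemma iid_rectangle (mu : probability T R) n (A : 'I_n -> set T) :
  (forall i, measurable (A i)) ->
  (iid mu n [set x | forall i, A i (tnth x i)] = \prod_(i < n) mu (A i))%E.
Proof.
elim: n A => [|n IHn] A mA.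
  by rewrite big_ord0 /= diracE mem_set//= => -[].
rewrite big_ord_recl -IHn// /distribution/pushforward /=.
rewrite -product_measure1E//; last first.
  rewrite (_ : [set _ | _] =
      \bigcap_(i in [set: 'I_n]) ((@tnth n T)^~ i @^-1` A (lift ord0 i))).
    apply: fin_bigcap_measurable => // i _.
    by rewrite -[X in measurable X]setTI; exact: measurable_tnth.
  by apply/seteqP; split=> x /= h i; [move=> _; exact: h|exact: h].
congr product_measure1; apply/seteqP; split=> -[x y] /=.
  move=> h; split=> [|i]; first exact: (h ord0).
  by have := h (lift ord0 i); rewrite tnthS.
move=> [h0 h] i; have [j ->|->//] := unliftP ord0 i.
by rewrite tnthS.
Qed.

End IIDSample.

Section DistanceMatrices.
Context (R : realType).

(* A pseudo-metric on symmetric matrices; the formula makes sense for all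
   square matrices.  (For N = 0 the set is empty and the value is 0.) *)
Definition dM N (A B : 'M[R]_N) : R :=
  inf [set rho : R | 0 < rho /\
    exists lam : {set 'I_N}, #|lam|%:R < N%:R * rho /\
      forall i j, i \notin lam -> j \notin lam -> `|A i j - B i j| < rho].

Definition permute_mx N (s : 'S_N) (B : 'M[R]_N) : 'M[R]_N :=
  row_perm s (col_perm s B).

(* Minimum over S_N: the initial value dM A B is the one at s = 1. *)
Definition dpi N (A B : 'M[R]_N) : R :=
  \big[Num.min/dM A B]_(s : 'S_N) dM A (permute_mx s B).

Definition is_distmx N : set 'M[R]_N :=
  [set A | [/\ A^T = A, (forall i j, 0 <= A i j), (forall i, A i i = 0)
             & forall i j k, A i j <= A i k + A k j]].

(* The subspace of distance matrices, with the induced topology. *)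
Definition distmx N := set_type (@is_distmx N).

HB.instance Definition _ N := Topological.on (distmx N).

Lemma is_distmx0 N : @is_distmx N 0.
Proof.
split=> [|i j|i|i j k]; first exact: trmx0.
- by rewrite mxE.
- by rewrite mxE.
- by rewrite !mxE addr0.
Qed.

HB.instance Definition _ N :=
  isPointed.Build (distmx N) (exist _ 0 (mem_set (@is_distmx0 N))).

Definition dpi_distmx N (A B : distmx N) : R := dpi (\val A) (\val B).

Lemma distmx_measurable_fun d (T : measurableType d) N (f : T -> borel (distmx N)) :
  (forall i j, measurable_fun setT (fun t => \val (f t) i j)) ->
  measurable_fun setT f.
Proof.
move=> mf; apply: (measurability (rT := borel (distmx N)) (@open (distmx N))) => // _ [U oU <-].
case: oU => W oW <-; rewrite setTI.
pose F (q : 'M[rat]_N * nat) := [set t |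
  @ball R 'M[R]_N (map_mx ratr q.1) q.2.+1%:R^-1 `<=` W /\
  @ball R 'M[R]_N (map_mx ratr q.1) q.2.+1%:R^-1 (\val (f t))].
rewrite (_ : _ @^-1` _ = \bigcup_q F q); last first.
  apply/seteqP; split=> [t /= Wt|t [q _ [+]]]; last exact.
  move: oW; rewrite openE => /(_ _ Wt); rewrite /interior -nbhs_ballE.
  move=> -[e /= e0 eW].
  have [k ke] : exists k : nat, k.+1%:R^-1 < e / 2.
    have e20 : 0 < (e / 2)^-1 by rewrite invr_gt0 divr_gt0.
    exists (Num.truncn (e / 2)^-1).
    rewrite invf_plt ?posrE ?divr_gt0//; exact: truncnS_gt.
  have k0 : 0 < k.+1%:R^-1 :> R by rewrite invr_gt0.
  have Q i j : {q : rat | `|ratr q - (\val (f t) : 'M[R]_N) i j| < k.+1%:R^-1}.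
    apply: cid; set a : R := fun_of_matrix _ i j; set c : R := _^-1 in k0 *.
    have /rat_in_itvoo[q] : a - c < a + c by lra.
    rewrite in_itv/= => /andP[? ?]; exists q.
    by rewrite ltr_distl; apply/andP; split; lra.
  pose A : 'M[rat]_N := \matrix_(i, j) sval (Q i j).
  have At : @ball R 'M[R]_N (map_mx ratr A) k.+1%:R^-1 (\val (f t)).
    split=> // i j; rewrite /ball/= !mxE; exact: (svalP (Q i j)).
  exists (A, k) => //; split=> //= M AM; apply: eW.
  have := ball_triangle (ball_sym At) AM.
  by apply: le_ball; rewrite [leRHS]splitr lerD// ltW.
apply: countable_bigcupT_measurable; first exact: countableP.
move=> [A k]; rewrite /F/=; set B := ball _ _.
have [BW|nBW] := pselect (B `<=` W); last first.
  by rewrite (_ : [set _ | _] = set0)//; apply/seteqP; split=> t //= -[].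
rewrite (_ : [set _ | _] = \bigcap_(ij in [set: 'I_N * 'I_N])
    ((fun t => \val (f t) ij.1 ij.2) @^-1` ball (ratr (A ij.1 ij.2) : R) k.+1%:R^-1)).
  apply: fin_bigcap_measurable => // ij _.
  by rewrite -[X in measurable X]setTI; apply: mf => //; exact: measurable_ball.
apply/seteqP; split=> t /=.
  by move=> [_ [_ h]] [i j] _ /=; have := h i j; rewrite mxE.
move=> h; split=> //; split=> [|i j]; first by rewrite invr_gt0.
by have := h (i, j) I; rewrite mxE.
Qed.

End DistanceMatrices.

Record mmSpace (R : realType) := MMSpace {
  mm_sort :> pmetricType R;
  mm_compact : compact [set: mm_sort];
  mm_mu : probability (borel mm_sort) R }.

Section SampledMatrix.
Context (R : realType) (X : mmSpace R).

Lemma measurable_mdist :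
  measurable_fun setT (fun z : borel X * borel X => mdist (z.1 : X) (z.2 : X)).
Proof.
apply: (measurability _ (RGenInftyO.measurableE R)).
move=> _ [_ [r ->] <-]; rewrite setTI.
have [B /pfcard_geP[B0|[g]] [Bo Bn]] := compact_second_countable (@mm_compact _ X).
  have := Bn point setT filterT; rewrite B0 => -[V /= [[]]].
pose F (nm : nat * nat) : set (borel X * borel X) :=
  [set z | (B (g nm.1) /\ B (g nm.2)) /\
    (forall x y, g nm.1 x -> g nm.2 y -> mdist x y < r) /\ g nm.1 z.1 /\ g nm.2 z.2].
rewrite (_ : _ @^-1` _ = \bigcup_nm F nm); last first.
  apply/seteqP; split=> -[x y] /=; rewrite in_itv/=; last first.
    by move=> [[n m] _ [_ [h [/= ? ?]]]]; exact: h.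
  move=> xyr; pose e := (r - mdist (x : X) y) / 2.
  have e0 : 0 < e by rewrite divr_gt0// subr_gt0.
  have [U /= [BU Ux] Ue] := Bn x _ (nbhsx_ballx (x : X) e e0).
  have [V /= [BV Vy] Ve] := Bn y _ (nbhsx_ballx (y : X) e e0).
  have [n _ gn] := @surj _ _ _ _ g U BU; have [m _ gm] := @surj _ _ _ _ g V BV.
  exists (n, m) => //; rewrite /F/= gn gm; split=> //; split=> // x' y' Ux' Vy'.
  have := Ue _ Ux'; have := Ve _ Vy'; rewrite !ballEmdist/= => yy' xx'.
  have := metric_triangle x' x y'; have := metric_triangle x y y'.
  by rewrite (metric_sym x' x); rewrite /e in xx' yy'; lra.
apply: countable_bigcupT_measurable; first exact: countableP.
move=> [n m]; rewrite /F/=.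
have [[[Bg Bm] h]|nh] := pselect ((B (g n) /\ B (g m)) /\
    forall x y, g n x -> g m y -> mdist x y < r); last first.
  by rewrite (_ : [set _ | _] = set0)//; apply/seteqP; split=> t //= [? [? ?]]; apply: nh.
rewrite (_ : [set _ | _] = g n `*` g m); last first.
  by apply/seteqP; split=> -[x y]/=; [move=> [_ []]|].
by apply: measurableX; apply: sub_sigma_algebra; exact: Bo.
Qed.

Definition mx_of_points N (x : N.-tuple X) : 'M[R]_N :=
  \matrix_(i, j) mdist (tnth x i) (tnth x j).

Lemma mx_of_points_is_distmx N (x : N.-tuple X) : is_distmx (mx_of_points x).
Proof.
split=> [|i j|i|i j k].
- by apply/matrixP=> i j; rewrite !mxE metric_sym.
- by rewrite mxE mdist_ge0.
- by rewrite mxE mdistxx.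
- by rewrite !mxE; exact: metric_triangle.
Qed.

Definition distmx_of_points N (x : N.-tuple (borel X)) : borel (distmx R N) :=
  exist _ (mx_of_points x) (mem_set (mx_of_points_is_distmx x)).

Lemma measurable_distmx_of_points N :
  measurable_fun setT (@distmx_of_points N).
Proof.
apply: distmx_measurable_fun => i j.
rewrite (_ : (fun _ => _) = (fun z : borel X * borel X => mdist (z.1 : X) (z.2 : X)) \o
    (fun x : N.-tuple (borel X) => (tnth x i, tnth x j))).
  apply: measurableT_comp; first exact: measurable_mdist.
  by apply/measurable_fun_pair; exact: measurable_tnth.
by apply/funext => x /=; rewrite mxE.
Qed.

HB.instance Definition _ N :=
  isMeasurableFun.Build _ _ (N.-tuple (borel X)) (borel (distmx R N))
    (@distmx_of_points N) (@measurable_distmx_of_points N).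

Definition theta N : probability (borel (distmx R N)) R :=
  distribution (iid (mm_mu X) N) (@distmx_of_points N).

End SampledMatrix.

Section GromovHausdorffProkhorov.
Context (R : realType).

Record isoEmb (X Z : pmetricType R) := IsoEmb {
  iso_fun :> X -> Z;
  iso_funP : forall x y : X, mdist (iso_fun x) (iso_fun y) = mdist x y }.

Lemma isoEmb_measurable (X Z : pmetricType R) (f : isoEmb X Z) :
  measurable_fun [set: borel X] (f : borel X -> borel Z).
Proof.
apply: (measurability (rT := borel Z) (@open Z)) => // _ [U oU <-]; rewrite setTI.
apply: sub_sigma_algebra; move: oU; rewrite !openE => oU x /oU.
rewrite /interior -!nbhs_ballE => -[e e0 eU]; exists e => // y.
by rewrite ballEmdist/= => xy; apply: eU; rewrite ballEmdist/= iso_funP.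
Qed.

HB.instance Definition _ (X Z : pmetricType R) (f : isoEmb X Z) :=
  isMeasurableFun.Build _ _ (borel X) (borel Z)
    (iso_fun f : borel X -> borel Z)
    (isoEmb_measurable f).

Definition dGHP (X Y : mmSpace R) : \bar R :=
  ereal_inf [set r | exists (Z : pmetricType R) (f : isoEmb X Z) (g : isoEmb Y Z),
    compact [set: Z] /\
    r = dP (distribution (mm_mu X) f) (distribution (mm_mu Y) g)
           (fun z1 z2 : borel Z => mdist (z1 : Z) (z2 : Z))].

End GromovHausdorffProkhorov.

(* Main.v *)
(* Part 1.  Given isometric embeddings in Z and a coupling of mu_X and mu_Y on
   Z * Z under which the two points are within r1 of each other with probability
   at least 1 - r1, sample N independent pairs from the coupling.  By the law of
   large numbers fewer than N * r of the pairs are at distance > r1, for any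
   r > r1; discarding these, the two distance matrices differ by at most 2 * r1
   entrywise.

   Part 2.  Cut X and Y into finitely many Borel cells of small diameter.  For
   infinitely many N there are samples x of X and y of Y that hit no cell much
   more often than expected and whose distance matrices are, after reordering y,
   e-close off a set lam of fewer than N * e indices.  Gluing X to Y by declaring
   x_i and y_i (i outside lam) to be at distance about e / 2 gives a compact metric
   space.  The pairs (x_i, y_i) put mass at least 1 - e on pairs of cells that are
   e-close in it; slightly scaled down, this is dominated by the cell masses of
   mu_X and mu_Y, so it extends to a coupling of these measures. *)

From HB Require Import structures.
Require Import Defs.
From mathcomp Require Import all_boot all_order all_algebra all_fingroup.
From mathcomp Require Import all_classical all_reals all_analysis.
From mathcomp Require Import measurable_realfun ring lra.

Set Implicit Arguments.
Unset Strict Implicit.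
Unset Printing Implicit Defensive.

Import Order.TTheory GRing.Theory Num.Theory.
Import numFieldNormedType.Exports.

Local Open Scope classical_set_scope.
Local Open Scope ring_scope.

(** * Independent samples and a Chernoff bound *)

Section IIDMap.
Context d d' (T : measurableType d) (T' : measurableType d') (R : realType).

Lemma measurable_map_tuple n (h : T -> T') : measurable_fun setT h ->
  measurable_fun setT (map_tuple (n := n) h).
Proof.
move=> mh; apply/measurable_fun_tnthP => i.
rewrite (_ : _ \o _ = h \o (fun x : n.-tuple T => tnth x i)).
  by apply: measurableT_comp => //; exact: measurable_tnth.
by apply/funext => x /=; rewrite tnth_map.
Qed.

(** Induction on [n]: a product measure is determined by its values on rectangles, where [h] acts
    coordinatewise. This serves for the two projections of a coupling and for isometric
    embeddings. *)
Lemma iid_map (P : probability T R) (Q : probability T' R) (h : T -> T') :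
  measurable_fun setT h -> (forall A, measurable A -> Q A = P (h @^-1` A)) ->
  forall n (A : set (n.-tuple T')), measurable A ->
  iid Q n A = iid P n (map_tuple h @^-1` A).
Proof.
move=> mh QE; elim=> [|n IHn] A mA.
  rewrite /= !diracE; congr (_%:R%:E); congr nat_of_bool.
  apply/idP/idP; rewrite !inE /=; first by rewrite (tuple0 (map_tuple _ _)).
  by rewrite (tuple0 (map_tuple _ _)).
pose hn (z : T * n.-tuple T) : T' * n.-tuple T' := (h z.1, map_tuple h z.2).
have mhn : measurable_fun setT hn.
  apply/measurable_fun_pair => /=.
    exact: measurableT_comp.
  by apply: measurableT_comp => //; apply: measurable_map_tuple.
pose Hn : {mfun _ >-> _} := mfun_Sub (mem_set mhn).
have mB : measurable (@tcons _ T' n @^-1` A).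
  by rewrite -[X in measurable X]setTI; exact: measurable_tcons.
have E : (Q \x iid Q n)%E (@tcons _ T' n @^-1` A) =
    distribution (P \x iid P n)%E Hn (@tcons _ T' n @^-1` A).
  apply: product_measure_unique mB => B C mB mC.
  rewrite -[RHS]/(Q B * iid Q n C)%E IHn// QE//.
  rewrite -[LHS]/((P \x iid P n)%E (hn @^-1` (B `*` C))).
  rewrite (_ : hn @^-1` _ = (h @^-1` B) `*` (map_tuple h @^-1` C))//.
  apply: product_measure1E.
  - by rewrite -[X in measurable X]setTI; exact: mh.
  - by rewrite -[X in measurable X]setTI; apply: measurable_map_tuple.
apply: etrans E _; rewrite /= /distribution /pushforward /=; congr product_measure1.
apply/seteqP; split => -[x y] /=; rewrite /tcons /hn /=;
  by rewrite (_ : [tuple of h x :: map_tuple h y] = map_tuple h [tuple of x :: y])//; apply/val_inj.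
Qed.

End IIDMap.

Section Chernoff.
Context d (T : measurableType d) (R : realType).
Implicit Types (P : probability T R) (A : set T).

Definition hits n A (x : n.-tuple T) : R := \sum_(i < n) \1_A (tnth x i).

Lemma measurable_hits n A : measurable A -> measurable_fun setT (@hits n A).
Proof.
move=> mA; apply: measurable_sum => i.
rewrite (_ : (fun x => _) = (\1_A : T -> R) \o (fun x : n.-tuple T => tnth x i))//.
apply: measurableT_comp; first exact: measurable_indic.
exact: measurable_tnth.
Qed.

Lemma measurable_hits_ge n A (r : R) : measurable A ->
  measurable [set x : n.-tuple T | r <= hits A x].
Proof.
move=> mA; rewrite -[X in measurable X]setTI.
rewrite (_ : [set x | _] = hits A @^-1` `[r, +oo[%classic).
  by apply: measurable_hits.
by apply/seteqP; split => x /=; rewrite in_itv/= andbT.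
Qed.

(* The threshold r is an arbitrary real, so that conditioning on the first sample
   lets the induction shift it by 1. *)
Lemma chernoff_bound P A (t r : R) n : measurable A -> 0 <= t ->
  (iid P n [set x | (r <= hits A x)%R] <=
   (expR (- (t * r)) * (1 - fine (P A) + fine (P A) * expR t) ^+ n)%:E)%E.
Proof.
move=> mA t0; set p := fine (P A).
have Pp : P A = p%:E by rewrite fineK// fin_num_measure.
have PCp : P (~` A) = (1 - p)%:E.
  by rewrite probability_setC// Pp.
have p0 : 0 <= p by rewrite fine_ge0.
have p1 : p <= 1 by rewrite -lee_fin -Pp; exact: probability_le1.
elim: n r => [|n IHn] r.
  rewrite /= diracE expr0 mulr1 lee_fin.
  have [|_] := boolP (_ \in _); last by rewrite expR_ge0.
  by rewrite inE /= /hits big_ord0 => r0; rewrite -expR0 ler_expR; nra.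
rewrite /= /distribution /pushforward.
rewrite (_ : _ @^-1` _ = (A `*` [set y : n.-tuple T | r - 1 <= hits A y]) `|`
    (~` A `*` [set y : n.-tuple T | r <= hits A y])); last first.
  apply/seteqP; split => -[x y] /=; rewrite /hits big_ord_recl.
  - under eq_bigr do rewrite tnthS.
    rewrite tnth0 indicE; have [/set_mem Ax|/negP Ax] := boolP (x \in A) => h.
      by left; split => //; rewrite lerBlDl.
    right; split; first by move=> Ax'; apply: Ax; rewrite inE.
    by rewrite add0r in h.
  - move=> [[Ax h]|[Ax h]]; under eq_bigr do rewrite tnthS.
      by rewrite tnth0 indicE mem_set// -lerBlDl.
    by rewrite tnth0 indicE memNset// add0r.
rewrite measureU/=; last 3 first.
- by apply: measurableX => //; exact: measurable_hits_ge.
- by apply: measurableX; [exact: measurableC|exact: measurable_hits_ge].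
- by apply/seteqP; split => // -[x y] [[/= ? _] [? _]].
have PE B C : measurable B -> measurable C ->
    (P \x iid P n)%E (B `*` C) = (P B * iid P n C)%E by exact: product_measure1E.
rewrite !PE//; try exact: measurable_hits_ge; try exact: measurableC.
rewrite Pp PCp.
apply: (@le_trans _ _ (p%:E * (expR (- (t * (r - 1))) * (1 - p + p * expR t) ^+ n)%:E +
  (1 - p)%:E * (expR (- (t * r)) * (1 - p + p * expR t) ^+ n)%:E)%E).
  by apply: leeD; apply: lee_wpmul2l => //; rewrite lee_fin ?subr_ge0.
rewrite -!EFinM -EFinD lee_fin exprS.
(* Lowering the threshold by 1 after a hit costs a factor [expR t], so the two cases add up to one
   more factor [1 - p + p * expR t]. *)
rewrite (_ : - (t * (r - 1)) = t + - (t * r)); last by ring.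
rewrite expRD; rewrite le_eqVlt; apply/orP; left; apply/eqP; ring.
Qed.

Lemma chernoff_rate (p q : R) : 0 <= p -> p < q ->
  exists2 t : R, 0 <= t & p * (expR t - 1) < t * q.
Proof.
move=> p0 pq.
have q0 : 0 < q by lra.
(* Chosen so that [q * (1 - t)] is the midpoint of [p] and [q], hence exceeds [p]. This suffices,
   since [expR t - 1 <= t / (1 - t)]. *)
pose t := (q - p) / (2 * q).
have t0 : 0 < t by rewrite divr_gt0//; lra.
have tq : t * q = (q - p) / 2 by rewrite /t; field; lra.
exists t; first exact: ltW.
have t1 : 0 < 1 - t by nra.
have et : expR t * (1 - t) <= 1.
  by rewrite -[leRHS](expRxMexpNx_1 t) ler_wpM2l ?expR_ge0// expR_ge1Dx.
rewrite -(ltr_pM2r t1) -mulrA mulrBl mul1r.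
have : p * (expR t * (1 - t) - (1 - t)) <= p * t by rewrite ler_wpM2l//; lra.
nra.
Qed.

(** Since [1 - p + p * expR t <= expR (p * (expR t - 1))], the Chernoff bound at threshold [n * q]
    is at most [expR (- k) ^+ n] with [k = t * q - p * (expR t - 1)], and [chernoff_rate] makes [k]
    positive. *)
Lemma LLN_hits_ge P A (q eta : R) : measurable A -> (P A < q%:E)%E -> 0 < eta ->
  \forall n \near \oo,
    (iid P n [set x | (n%:R * q <= hits A x)%R] <= eta%:E)%E.
Proof.
move=> mA PAq eta0.
have p0 : 0 <= fine (P A) by rewrite fine_ge0.
have pq : fine (P A) < q by rewrite -lte_fin fineK// fin_num_measure.
have [t t0 k0] := chernoff_rate p0 pq.
have bound r n := chernoff_bound P r n mA t0.
move: (fine (P A)) pq p0 k0 bound => p pq p0 k0 bound.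
pose k := t * q - p * (expR t - 1).
have k1 : 0 < k by rewrite subr_gt0.
have c1 : `|expR (- k)| < 1.
  by rewrite ger0_norm ?expR_ge0// -expR0 ltr_expR; lra.
have := cvg_expr c1; move=> /cvgrPdist_lt /(_ _ eta0); apply: filterS => n.
rewrite sub0r normrN ger0_norm ?exprn_ge0 ?expR_ge0// => h.
apply: le_trans (bound _ _) _.
rewrite lee_fin (le_trans _ (ltW h))//.
have : 1 - p + p * expR t <= expR (p * (expR t - 1)).
  by apply: le_trans (expR_ge1Dx _); lra.
have s0 : 0 <= 1 - p + p * expR t.
  have : 1 <= expR t by rewrite -expR0 ler_expR.
  nra.
move=> /(lerXn2r n s0 (expR_ge0 _)).
rewrite -!expRM_natl => h'.
apply: le_trans (ler_wpM2l (expR_ge0 _) h') _.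
by rewrite -expRD ler_expR le_eqVlt /k; apply/orP; left; apply/eqP; ring.
Qed.

(** For mass 0 the Chernoff bound at threshold 1 is [expR (- t)] for every [t >= 0]; taking
    [t = e^-1] brings it below [e]. *)
Lemma iid_hits_null P A n : measurable A -> P A = 0%E ->
  iid P n [set x | (1 <= hits A x)%R] = 0%E.
Proof.
move=> mA PA0; apply/eqP; rewrite eq_le measure_ge0 andbT.
apply/lee_addgt0Pr => e e0; rewrite add0e.
have := @chernoff_bound P A e^-1 1 n mA; rewrite PA0/=.
rewrite subr0 mul0r addr0 expr1n !mulr1 invr_ge0 ltW// => /(_ isT) /le_trans; apply.
rewrite lee_fin expRN -[leRHS]invrK lef_pV2 ?posrE ?expR_gt0 ?invr_gt0//.
by apply: le_trans (expR_ge1Dx _); lra.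
Qed.

(* A set of mass 0 is covered too: it is almost surely never hit. *)
Lemma LLN_hits_gt P A (c eta : R) : measurable A -> 1 < c -> 0 < eta ->
  \forall n \near \oo,
    (iid P n [set x | (n%:R * (c * fine (P A)) < hits A x)%R] <= eta%:E)%E.
Proof.
move=> mA c1 eta0.
(* For mass 0 the threshold is 0, and exceeding it means at least one hit. For positive mass [P A]
   is strictly below [c] times itself, so [LLN_hits_ge] applies. *)
have [PA0|PA0] := eqVneq (P A) 0%E.
  apply: nearW => n; apply: (@le_trans _ _ 0%E); last by rewrite lee_fin ltW.
  rewrite -(iid_hits_null n mA PA0) PA0 /= !mulr0 le_measure ?inE//=.
  - rewrite (_ : [set _ | _] = ~` [set x | hits A x <= 0]).
      apply: measurableC; rewrite -[X in measurable X]setTI.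
      rewrite (_ : [set x | _] = hits A @^-1` `]-oo, 0]%classic).
        by apply: measurable_hits.
      by apply/seteqP; split => x /=; rewrite in_itv/=.
    by apply/seteqP; split => x /=; [rewrite ltNge => /negP|move=> /negP; rewrite -ltNge].
  - exact: measurable_hits_ge.
  - move=> x /=; rewrite /hits.
    case: (pselect (exists i, A (tnth x i))) => [[i Ai] _|nA].
      rewrite (bigD1 i)//= indicE mem_set// lerDl sumr_ge0 // => j _; rewrite indicE.
    rewrite big1 ?ltxx// => i _; rewrite indicE memNset//= => Ai.
    by apply: nA; exists i.
have p0 : 0 < fine (P A).
  by rewrite fine_gt0// lt_neqAle eq_sym PA0 measure_ge0/= -ge0_fin_numE// fin_num_measure.
have : (P A < (c * fine (P A))%:E)%E.
  by rewrite -[ltLHS]fineK ?fin_num_measure// lte_fin ltr_pMl.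
move=> /LLN_hits_ge => /(_ eta mA eta0); apply: filterS => n.
apply: le_trans; rewrite le_measure ?inE//=.
- rewrite (_ : [set _ | _] = hits A @^-1` `]n%:R * (c * fine (P A)), +oo[%classic).
    by rewrite -[X in measurable X]setTI; apply: measurable_hits.
  by apply/seteqP; split => x /=; rewrite in_itv/= andbT.
- exact: measurable_hits_ge.
- by move=> x /= /ltW.
Qed.

End Chernoff.

(** * The distances between matrices *)

Section MatrixDistances.
Context (R : realType) (N : nat).
Implicit Types A B : 'M[R]_N.

Lemma dM_le A B (r : R) (lam : {set 'I_N}) : 0 < r -> #|lam|%:R < N%:R * r ->
  (forall i j, i \notin lam -> j \notin lam -> `|A i j - B i j| < r) ->
  dM A B <= r.
Proof.
move=> r0 lamN AB; apply: ge_inf; last by split=> //; exists lam.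
by exists 0 => rho [/ltW].
Qed.

(** Finitely many strict inequalities hold at [r], so they still hold at some [rho] slightly below
    [r], and this [rho] bounds the infimum. *)
Lemma dM_lt A B (r : R) (lam : {set 'I_N}) : #|lam|%:R < N%:R * r ->
  (forall i j, i \notin lam -> j \notin lam -> `|A i j - B i j| < r) ->
  dM A B < r.
Proof.
move=> lamN AB.
have N0 : 0 < N%:R :> R.
  rewrite lt_neqAle ler0n andbT eq_sym; apply/eqP => N0.
  by move: lamN; rewrite N0 mul0r ltNge ler0n.
have r0 : 0 < r by rewrite -(pmulr_rgt0 _ N0); exact: le_lt_trans lamN.
have : \forall rho \near r^'-, [/\ rho < r, 0 < rho, #|lam|%:R < N%:R * rho &
    forall ij : 'I_N * 'I_N, ij.1 \notin lam -> ij.2 \notin lam ->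
      `|A ij.1 ij.2 - B ij.1 ij.2| < rho].
  near=> rho; split.
  - by near: rho; exact: nbhs_left_lt.
  - by near: rho; exact: nbhs_left_gt.
  - rewrite mulrC -ltr_pdivrMr//; near: rho; apply: nbhs_left_gt.
    by rewrite ltr_pdivrMr// mulrC.
  - near: rho; apply: filter_forall => -[i j] /=.
    have [il|il] := boolP (i \in lam); first by apply: nearW.
    have [jl|jl] := boolP (j \in lam); first by apply: nearW.
    by apply: filterS (nbhs_left_gt (AB _ _ il jl)).
move=> /filter_ex[rho [rhor rho0 lamrho ABrho]].
apply: le_lt_trans rhor; apply: dM_le lamrho _ => // i j.
exact: (ABrho (i, j)).
Unshelve. all: by end_near. Qed.

Lemma dM_ltP A B (r : R) : (0 < N)%N -> dM A B < r ->
  exists2 lam : {set 'I_N}, #|lam|%:R < N%:R * r &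
    forall i j, i \notin lam -> j \notin lam -> `|A i j - B i j| < r.
Proof.
move=> N0 /inf_lt[|rho [rho0 [lam [lamN AB]]] rhor].
  (* The infimum must be over a nonempty set: [K + 1] exceeds every entry of the difference, so it
     is admissible with no index discarded. *)
  pose K := \sum_i \sum_j `|A i j - B i j|.
  have K0 : 0 <= K by apply: sumr_ge0 => i _; apply: sumr_ge0.
  exists (K + 1); split; first by rewrite ltr_wpDl.
  exists finset.set0; rewrite cards0; split.
    by rewrite mulr_gt0 ?ltr0n// ltr_wpDl.
  move=> i j _ _; rewrite ltr_pwDr// /K (bigD1 i)//= (bigD1 j)//= -addrA lerDl.
  by rewrite addr_ge0// ?sumr_ge0// => k _; rewrite sumr_ge0.
exists lam.
  by apply: lt_trans lamN _; rewrite ltr_pM2l// ltr0n.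
by move=> i j il jl; apply: lt_trans rhor; exact: AB.
Qed.

Lemma permute_mxE (s : 'S_N) B i j : permute_mx s B i j = B (s i) (s j).
Proof. by rewrite /permute_mx !mxE. Qed.

Lemma dpi_lt A B (r : R) (s : 'S_N) : dM A (permute_mx s B) < r -> dpi A B < r.
Proof. by apply: le_lt_trans; exact: bigmin_le. Qed.

Lemma dpi_ltP A B (r : R) : dpi A B < r -> exists s : 'S_N, dM A (permute_mx s B) < r.
Proof.
move=> ABr; apply: contrapT => /forallNP H; move: ABr; apply/negP; rewrite -leNgt.
apply/bigmin_geP; split => [|s _]; last by rewrite leNgt; apply/negP/H.
rewrite leNgt; apply/negP => ABr; apply: (H 1%g).
rewrite (_ : permute_mx _ _ = B)//; apply/matrixP => i j.
by rewrite permute_mxE !perm1.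
Qed.

Lemma measurable_distmx_entry i j :
  measurable_fun setT (fun A : borel (distmx R N) => (\val A : 'M[R]_N) i j).
Proof.
apply: (measurability _ (RGenInftyO.measurableE R)).
move=> _ [_ [r ->] <-]; rewrite setTI; apply: sub_sigma_algebra.
exists [set M : 'M[R]_N | M i j < r].
  have /continuousP/(_ _ (@open_lt R r)) := @coord_continuous R N N i j.
  exact.
by apply/seteqP; split => A /=; rewrite in_itv.
Qed.

(** By [dpi_ltP] and [dM_ltP], a sublevel set is a finite union, over permutations and sets of
    discarded indices, of finite intersections of conditions on entries. *)
Lemma measurable_dpi : (0 < N)%N ->
  measurable_fun setT
    (fun z : borel (distmx R N) * borel (distmx R N) => dpi_distmx z.1 z.2).
Proof.
move=> N0; apply: (measurability _ (RGenInftyO.measurableE R)).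
move=> _ [_ [r ->] <-]; rewrite setTI.
pose F (s : 'S_N) (lam : {set 'I_N}) := [set z : borel (distmx R N) * borel (distmx R N) |
  #|lam|%:R < N%:R * r /\ forall ij : 'I_N * 'I_N, ij.1 \notin lam -> ij.2 \notin lam ->
  `|(\val z.1 : 'M[R]_N) ij.1 ij.2 - (\val z.2 : 'M[R]_N) (s ij.1) (s ij.2)| < r].
rewrite (_ : _ @^-1` _ = \bigcup_(sl in [set: 'S_N * {set 'I_N}]) F sl.1 sl.2); last first.
  apply/seteqP; split => -[A B] /=; rewrite in_itv/=.
    move=> /dpi_ltP[s /(dM_ltP N0)[lam lamN AB]].
    exists (s, lam) => //=; split => // -[i j] /= il jl.
    by rewrite -permute_mxE; exact: AB.
  move=> [[s lam] _ /= [lamN AB]]; apply: (@dpi_lt _ _ _ s); apply: dM_lt lamN _ => i j il jl.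
  by rewrite permute_mxE; exact: (AB (i, j)).
apply: fin_bigcup_measurable => [|[s lam] _]; first exact: finite_finset.
rewrite /F/=.
have [lamN|lamN] := pselect (#|lam|%:R < N%:R * r); last first.
  by rewrite (_ : [set _ | _] = set0)//; apply/seteqP; split=> z //= -[].
rewrite (_ : [set _ | _] =
  \bigcap_(ij in [set ij : 'I_N * 'I_N | ij.1 \notin lam /\ ij.2 \notin lam])
    ((fun z : borel (distmx R N) * borel (distmx R N) =>
      `|(\val z.1 : 'M[R]_N) ij.1 ij.2 - (\val z.2 : 'M[R]_N) (s ij.1) (s ij.2)|)
      @^-1` `]-oo, r[%classic)).
  apply: fin_bigcap_measurable => [|[i j] _]; first exact: finite_finset.
  rewrite -[X in measurable X]setTI.
  suff mf : measurable_fun setT (fun z : borel (distmx R N) * borel (distmx R N) =>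
      (\val z.1 : 'M[R]_N) i j - (\val z.2 : 'M[R]_N) (s i) (s j)).
    by apply: (measurableT_comp (@normr_measurable R setT) mf).
  apply: measurable_funB.
    exact: (measurableT_comp (measurable_distmx_entry i j) measurable_fst).
  exact: (measurableT_comp (measurable_distmx_entry (s i) (s j)) measurable_snd).
apply/seteqP; split => z /=.
  by move=> [_ h] ij [? ?]; rewrite /= in_itv/=; exact: h.
move=> h; split=> // ij il jl.
by have := h ij (conj il jl); rewrite /= in_itv.
Qed.

Lemma measurable_dpi_le (r : R) : (0 < N)%N ->
  measurable [set z : borel (distmx R N) * borel (distmx R N) | dpi_distmx z.1 z.2 <= r].
Proof.
move=> N0; rewrite -[X in measurable X]setTI.
rewrite (_ : [set z | _] = (fun z => dpi_distmx z.1 z.2) @^-1` `]-oo, r]%classic).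
  by apply: measurable_dpi.
by apply/seteqP; split => z /=; rewrite in_itv.
Qed.

End MatrixDistances.

Lemma measurable_mdist_le (R : realType) (X : mmSpace R) (r : R) :
  measurable [set z : borel X * borel X | mdist (z.1 : X) (z.2 : X) <= r].
Proof.
rewrite -[X in measurable X]setTI.
rewrite (_ : [set z | _] = (fun z => mdist (z.1 : X) (z.2 : X)) @^-1` `]-oo, r]%classic).
  by apply: measurable_mdist.
by apply/seteqP; split => z /=; rewrite in_itv.
Qed.

(** * The upper bound *)

Section ProkhorovBounds.
Context d (T : measurableType d) (R : realType) (P1 P2 : probability T R).
Context (dist : T -> T -> R).
Local Open Scope ereal_scope.

Lemma dP_le (th : probability (T * T)%type R) (r : R) : coupling P1 P2 th ->
  (0 < r)%R -> (1 - r)%:E <= th [set z | (dist z.1 z.2 <= r)%R] ->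
  dP P1 P2 dist <= r%:E.
Proof.
move=> cth r0 thr; apply: (@le_trans _ _ (Delta th dist)).
  by apply: ereal_inf_lbound; exists th.
by apply: ereal_inf_lbound; exists r.
Qed.

Lemma dP_ltP (e : \bar R) : dP P1 P2 dist < e ->
  exists (th : probability (T * T)%type R) (r : R),
    [/\ coupling P1 P2 th, (0 < r)%R, r%:E < e &
      (1 - r)%:E <= th [set z | (dist z.1 z.2 <= r)%R]].
Proof.
move=> /ereal_inf_lt[_ [th cth <-]] /ereal_inf_lt[_ [r [r0 thr] <-] re].
by exists th, r.
Qed.

Lemma dP_ge0 : 0 <= dP P1 P2 dist.
Proof.
apply: le_ereal_inf_tmp => _ [th _ <-]; apply: le_ereal_inf_tmp => _ [r [r0 _] <-].
by rewrite lee_fin ltW.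
Qed.

End ProkhorovBounds.

Lemma hits_card d (T : measurableType d) (R : realType) n (A : set T) (x : n.-tuple T) :
  @hits _ _ R n A x = #|[set i | tnth x i \in A]%SET|%:R.
Proof.
rewrite /hits -sum1_card natr_sum [RHS]big_mkcond/=; apply: eq_bigr => i _.
by rewrite indicE !inE; case: (_ \in _).
Qed.

(** * Sampling distance matrices from a coupling *)

Section SampleCoupling.
Context (R : realType) (Z : pmetricType R) (cZ : compact [set: Z]).
Context (P1 P2 : probability (borel Z) R).
Context (th : probability (borel Z * borel Z)%type R).
Hypothesis cth : coupling P1 P2 th.

Let W1 := MMSpace cZ P1.
Let W2 := MMSpace cZ P2.

Let matrices N (w : N.-tuple (borel Z * borel Z)%type) :
    borel (distmx R N) * borel (distmx R N) :=
  (@distmx_of_points R W1 N (map_tuple fst w), @distmx_of_points R W2 N (map_tuple snd w)).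

Let measurable_matrices N : measurable_fun setT (@matrices N).
Proof.
apply/measurable_fun_pair => /=.
  exact: (measurableT_comp (@measurable_distmx_of_points R W1 N)
    (measurable_map_tuple measurable_fst)).
exact: (measurableT_comp (@measurable_distmx_of_points R W2 N)
    (measurable_map_tuple measurable_snd)).
Qed.

HB.instance Definition _ N := isMeasurableFun.Build _ _ _ _ (@matrices N)
  (@measurable_matrices N).

(** The first coordinates of independent pairs with law [th] are independent points with law [P1],
    by [iid_map]; likewise the second ones with law [P2]. *)
Lemma coupling_matrices N :
  coupling (theta W1 N) (theta W2 N) (distribution (iid th N) (@matrices N)).
Proof.
move=> A mA; split.
  have -> : theta W1 N A = iid P1 N (@distmx_of_points R W1 N @^-1` A) by [].
  rewrite (iid_map measurable_fst (P := th)).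
  - by rewrite /distribution /pushforward; congr (iid _ _ _); apply/seteqP; split => w //= [].
  - by move=> B mB; rewrite -(cth mB).1; congr (th _); apply/seteqP; split => w //= [].
  - by rewrite -[X in measurable X]setTI; exact: (@measurable_distmx_of_points R W1 N).
have -> : theta W2 N A = iid P2 N (@distmx_of_points R W2 N @^-1` A) by [].
rewrite (iid_map measurable_snd (P := th)).
- by rewrite /distribution /pushforward; congr (iid _ _ _); apply/seteqP; split => w //= [].
- by move=> B mB; rewrite -(cth mB).2; congr (th _); apply/seteqP; split => w //= [].
- by rewrite -[X in measurable X]setTI; exact: (@measurable_distmx_of_points R W2 N).
Qed.

Lemma dP_theta_le (r1 r : R) : 0 < r1 -> r1 < r ->
  ((1 - r1)%:E <= th [set z | (mdist (z.1 : Z) (z.2 : Z) <= r1)%R])%E ->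
  \forall N \near \oo, (dP (theta W1 N) (theta W2 N) (@dpi_distmx R N) <= (2 * r)%R%:E)%E.
Proof.
move=> r10 r1r thr.
pose G : set (borel Z * borel Z)%type := [set z | mdist (z.1 : Z) (z.2 : Z) <= r1].
have mG : measurable G by exact: (@measurable_mdist_le R W1).
have thB : (th (~` G) < r%:E)%E.
  rewrite probability_setC//; apply: (@le_lt_trans _ _ r1%:E); last by rewrite lte_fin.
  by rewrite leeBlDr ?fin_num_measure//; move: thr; rewrite EFinB leeBlDl.
(* The number [2 * r] bounds both the distance and the exceptional mass. The latter tends to 0, so
   any positive bound on it would do. *)
have r20 : 0 < 2 * r by lra.
have := LLN_hits_ge (measurableC mG) thB r20.
move=> LLN; near=> N.
have N0 : (0 < N)%N by near: N; exact: nbhs_infty_gt.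
apply: (dP_le (@coupling_matrices N)) => //.
rewrite -[leRHS]/(iid th N (@matrices N @^-1` [set z | dpi_distmx z.1 z.2 <= 2 * r])).
have le1 : ((1 - 2 * r)%:E <= iid th N (~` [set w | (N%:R * r <= hits R (~` G) w)%R]))%E.
  rewrite probability_setC; last exact: measurable_hits_ge (measurableC mG).
  rewrite EFinB leeB//; near: N; exact: LLN.
apply: le_trans le1 _; rewrite le_measure ?inE//=.
- by apply: measurableC; apply: measurable_hits_ge; apply: measurableC.
- rewrite -[X in measurable X]setTI; apply: measurable_matrices => //.
  exact: measurable_dpi_le.
move=> w /= /negP; rewrite -ltNge hits_card => wr.
(* The coupling already matches the indices, so the identity permutation suffices. *)
apply: (@le_trans _ _ (dM (mx_of_points (X := W1) (map_tuple fst w))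
   (mx_of_points (X := W2) (map_tuple snd w)))).
  exact: bigmin_le_id.
apply: dM_le => //.
  apply: lt_trans wr _; rewrite ltr_pM2l ?ltr0n//; lra.
have good i : i \notin [set i | tnth w i \in ~` G]%SET ->
    mdist ((tnth w i).1 : Z) (tnth w i).2 <= r1.
  by move=> iG; apply: contrapT => h; move/negP: iG; apply; rewrite finset.inE; exact/mem_set.
move=> i j /good ir /good jr; rewrite !mxE !tnth_map.
move: (tnth w i) (tnth w j) ir jr => -[a a'] [b b'] /= aa bb.
(* The distances between [a], [b] and between [a'], [b'] differ by at most [2 * r1], which is
   strictly below [2 * r]. *)
have h1 := metric_triangle a a' b; have h2 := metric_triangle a' b' b.
have h3 := metric_triangle a' a b'; have h4 := metric_triangle a b b'.
rewrite (metric_sym b' b) in h2; rewrite (metric_sym a' a) in h3.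
rewrite ltr_norml; apply/andP; split; lra.
Unshelve. all: by end_near. Qed.

End SampleCoupling.

Section Isometry.
Context (R : realType) (X : mmSpace R) (Z : pmetricType R) (cZ : compact [set: Z]).
Context (f : isoEmb X Z).

(** An isometric embedding preserves the distance matrix of every sample. Hence both spaces may be
    sampled inside a common [Z]. *)
Lemma theta_isometry N (A : set (borel (distmx R N))) : measurable A ->
  theta (MMSpace cZ (distribution (mm_mu X) f)) N A = theta X N A.
Proof.
move=> mA; set W := MMSpace _ _.
have -> : theta W N A = iid (mm_mu W) N (@distmx_of_points R W N @^-1` A) by [].
rewrite (iid_map (@isoEmb_measurable _ _ _ f) (P := mm_mu X))//.
  rewrite /theta /distribution /pushforward; congr (iid _ _ _).
  have E x : distmx_of_points (X := W) (map_tuple f x) = distmx_of_points (X := X) x.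
    by apply/val_inj/matrixP => i j; rewrite !mxE !tnth_map iso_funP.
  by apply/seteqP; split => x /=; rewrite E.
by rewrite -[X in measurable X]setTI; exact: (@measurable_distmx_of_points R W N).
Qed.

End Isometry.

Lemma eq_dP d (T : measurableType d) (R : realType) (P1 P2 Q1 Q2 : probability T R) dist :
  (forall A, measurable A -> P1 A = Q1 A) -> (forall A, measurable A -> P2 A = Q2 A) ->
  dP P1 P2 dist = dP Q1 Q2 dist.
Proof.
move=> P1Q1 P2Q2; rewrite /dP; congr ereal_inf.
apply/seteqP; split => _ [th cth <-]; exists th => // A mA.
- by rewrite -P1Q1// -P2Q2//; exact: cth.
- by rewrite P1Q1// P2Q2//; exact: cth.
Qed.

Lemma limn_esup_le (R : realType) (u : (\bar R)^nat) (c : \bar R) :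
  (\forall n \near \oo, (u n <= c)%E) -> (limn_esup u <= c)%E.
Proof.
move=> [n _ un]; rewrite /limn_esup limf_esupE.
apply: (@le_trans _ _ (ereal_sup [set u k | k in [set k | (n <= k)%N]])).
  by apply: ereal_inf_lbound; exists [set k | (n <= k)%N] => //; exists n.
by apply: ge_ereal_sup => _ [k nk <-]; exact: un.
Qed.

Lemma dGHP_ge0 (R : realType) (X Y : mmSpace R) : (0 <= dGHP X Y)%E.
Proof.
by apply: le_ereal_inf_tmp => _ [Z [f [g [_ ->]]]]; exact: dP_ge0.
Qed.

Lemma limn_esup_dP_theta_le (R : realType) (X Y : mmSpace R) :
  (limn_esup (fun N => dP (theta X N) (theta Y N) (@dpi_distmx R N))
     <= 2%:E * dGHP X Y)%E.
Proof.
have [->|dfin] := eqVneq (dGHP X Y) +oo%E; first by rewrite mulry gtr0_sg// mul1e leey.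
have dE : dGHP X Y = (fine (dGHP X Y))%:E.
  by rewrite fineK// ge0_fin_numE ?dGHP_ge0// ltey.
move: (fine _) dE => s dE; apply/lee_addgt0Pr => e e0.
(* Half of the slack, because [dP_theta_le] doubles it. *)
have : (dGHP X Y < (s + e / 2)%:E)%E by rewrite dE lte_fin; lra.
move=> /ereal_inf_lt[_ [Z [f [g [cZ ->]]]]] /dP_ltP[th [r1 [cth r10]]].
rewrite lte_fin => r1s thr.
rewrite dE -EFinM -EFinD (_ : 2 * s + e = 2 * (s + e / 2)); last by lra.
apply: limn_esup_le.
apply: filterS (dP_theta_le cZ cth r10 r1s thr) => N; apply: le_trans.
rewrite le_eqVlt; apply/orP; left; apply/eqP; apply: eq_dP => A mA; exact/esym/theta_isometry.
Qed.

(** * Extending a partial coupling *)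

(** The masses [a] and [b] missing from the two marginals have the same total [1 - c > 0]; adding
    their product divided by [1 - c] fills both. *)
Lemma subcoupling_extend (R : realType) (I J : finType) (p : I -> R) (p' : J -> R)
    (q : I -> J -> R) :
  (forall i, \sum_j q i j <= p i) -> (forall j, \sum_i q i j <= p' j) ->
  \sum_i p i = 1 -> \sum_j p' j = 1 -> \sum_i \sum_j q i j < 1 ->
  exists m : I -> J -> R, [/\ forall i j, q i j <= m i j,
    forall i, \sum_j m i j = p i & forall j, \sum_i m i j = p' j].
Proof.
move=> qp qp' p1 p'1 q1; set c := \sum_i \sum_j q i j in q1.
have c0 : 0 < 1 - c by rewrite subr_gt0.
pose a i := p i - \sum_j q i j; pose b j := p' j - \sum_i q i j.
have a1 : \sum_i a i = 1 - c by rewrite sumrB p1.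
have b1 : \sum_j b j = 1 - c by rewrite sumrB p'1 exchange_big.
exists (fun i j => q i j + a i * b j / (1 - c)); split=> [i j|i|j].
- by rewrite lerDl divr_ge0 ?(ltW c0)// mulr_ge0// subr_ge0.
- rewrite big_split/= -mulr_suml -mulr_sumr b1 mulfK ?gt_eqF//.
  by rewrite addrC subrK.
- rewrite big_split/= -mulr_suml -mulr_suml a1 mulrC mulKf ?gt_eqF//.
  by rewrite addrC subrK.
Qed.

Section Cells.
Context d (T : measurableType d) (R : realType) (I : finType) (cell : T -> I).
Hypothesis mcell : forall i, measurable (cell @^-1` [set i]).

Lemma measure_cells (mu : {measure set T -> \bar R}) (C : set T) : measurable C ->
  mu C = (\sum_(i : I) mu (C `&` cell @^-1` [set i]))%E.
Proof.
move=> mC; rewrite [in LHS](_ : C = \bigcup_(i in [set: I]) (C `&` cell @^-1` [set i])).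
  rewrite measure_fin_bigcup//=.
  - rewrite (fsbigE (index_enum I)) ?index_enum_uniq//=; last first.
      by move=> i _; rewrite mem_index_enum.
    by apply: eq_bigl => i; rewrite in_setT.
  - by move=> i j _ _ [x [[_ <-] [_ <-]]].
  - by move=> i _; apply: measurableI.
by apply/seteqP; split=> [x Cx|x [i _ []]//]; exists (cell x).
Qed.

End Cells.

(** * Couplings with prescribed masses on pairs of cells *)

Section StepCoupling.
Context d1 d2 (T1 : measurableType d1) (T2 : measurableType d2) (R : realType).
Context (P1 : probability T1 R) (P2 : probability T2 R).

(** This is the measure whose density with respect to [P1 \x P2] is the step function with weights
    [w] on the sets [D], built one term at a time. *)
Lemma sum_mrestr_measure (I : eqType) (s : seq I) (w : I -> R) (D : I -> set (T1 * T2)) :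
  (forall i, 0 <= w i) -> (forall i, measurable (D i)) ->
  exists mu : {measure set (T1 * T2) -> \bar R},
    forall S, mu S = (\sum_(i <- s) (w i)%:E * (P1 \x P2) (S `&` D i))%E.
Proof.
move=> w0 mD; elim: s => [|i s [mu muE]]; first by exists mzero => S; rewrite big_nil.
exists (measure_add (mscale (NngNum (w0 i)) (mrestr (P1 \x P2)%E (mD i))) mu) => S.
by rewrite big_cons -muE; exact: measure_addE.
Qed.

Context (I J : finType) (c1 : T1 -> I) (c2 : T2 -> J).
Hypothesis mc1 : forall i, measurable (c1 @^-1` [set i]).
Hypothesis mc2 : forall j, measurable (c2 @^-1` [set j]).
Variable m : I -> J -> R.
Hypothesis m0 : forall i j, 0 <= m i j.
Let p i := fine (P1 (c1 @^-1` [set i])).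
Let p' j := fine (P2 (c2 @^-1` [set j])).
Hypothesis m1 : forall i, \sum_j m i j = p i.
Hypothesis m2 : forall j, \sum_i m i j = p' j.

Let m1_0 i j : p i = 0 -> m i j = 0.
Proof. by move=> pi0; apply/eqP; move: (m1 i); rewrite pi0 => /psumr_eq0P ->. Qed.

Let m2_0 i j : p' j = 0 -> m i j = 0.
Proof. by move=> pj0; apply/eqP; move: (m2 j); rewrite pj0 => /psumr_eq0P ->. Qed.

(* Conditionally on the pair of cells (i, j), drawn with probability m i j, the two
   points are independent.  Cells of mass 0 are harmless: there m i j = 0, and
   division by 0 gives 0. *)
Lemma step_coupling : exists th : probability (T1 * T2)%type R,
  [/\ forall A, measurable A -> th (A `*` setT) = P1 A,
      forall A, measurable A -> th (setT `*` A) = P2 A &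
      forall i j, th ((c1 @^-1` [set i]) `*` (c2 @^-1` [set j])) = (m i j)%:E].
Proof.
pose w (ij : I * J) := m ij.1 ij.2 / (p ij.1 * p' ij.2).
have w0 ij : 0 <= w ij by rewrite divr_ge0// mulr_ge0// fine_ge0.
have mD (ij : I * J) : measurable ((c1 @^-1` [set ij.1]) `*` (c2 @^-1` [set ij.2])).
  exact: measurableX.
have [mu muE] := sum_mrestr_measure (index_enum (I * J)%type) w0 mD.
have muX A B : measurable A -> measurable B -> mu (A `*` B) =
    (\sum_i \sum_j m i j / (p i * p' j) * (fine (P1 (A `&` c1 @^-1` [set i])) *
      fine (P2 (B `&` c2 @^-1` [set j]))))%:E.
  move=> mA mB; rewrite muE pair_bigA/= -sumEFin; apply: eq_bigr => -[i j] _ /=.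
  rewrite -setXI /w/= [RHS]EFinM; congr (_ * _)%E.
  rewrite EFinM !fineK ?fin_num_measure//; try exact: measurableI.
  by apply: product_measure1E; exact: measurableI.
have p0 i : 0 <= p i by rewrite fine_ge0.
have p'0 j : 0 <= p' j by rewrite fine_ge0.
have mu1 A : measurable A -> mu (A `*` setT) = P1 A.
  move=> mA; rewrite muX// (measure_cells mc1 _ mA).
  transitivity (\sum_i fine (P1 (A `&` c1 @^-1` [set i])))%:E; last first.
    by rewrite -sumEFin; apply: eq_bigr => i _; rewrite fineK// fin_num_measure//;
      exact: measurableI.
  congr _%:E; apply: eq_bigr => i _.
  have ai : fine (P1 (A `&` c1 @^-1` [set i])) <= p i.
    rewrite fine_le ?fin_num_measure//; first exact: measurableI.
    by rewrite le_measure ?inE//; exact: measurableI.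
  have a0 : 0 <= fine (P1 (A `&` c1 @^-1` [set i])) by rewrite fine_ge0.
  move: (fine _) ai a0 => a ai a0.
  (* Here [p' j] cancels, and then the row sum [m1] cancels [p i]. If [p i = 0], then [a = 0] by
     [ai]. *)
  transitivity (\sum_j m i j / p i * a).
    apply: eq_bigr => j _; rewrite setTI -/(p' j).
    have [pj0|pj0] := eqVneq (p' j) 0; first by rewrite m2_0// !mul0r.
    have [pi0|pi0] := eqVneq (p i) 0; first by rewrite m1_0// !mul0r.
    by field; rewrite pj0 pi0.
  rewrite -!mulr_suml m1; have [pi0|pi0] := eqVneq (p i) 0; last by rewrite divff// mul1r.
  by rewrite pi0 mul0r; rewrite pi0 in ai; lra.
have mu2 A : measurable A -> mu (setT `*` A) = P2 A.
  move=> mA; rewrite muX// (measure_cells mc2 _ mA) exchange_big/=.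
  transitivity (\sum_j fine (P2 (A `&` c2 @^-1` [set j])))%:E; last first.
    by rewrite -sumEFin; apply: eq_bigr => i _; rewrite fineK// fin_num_measure//;
      exact: measurableI.
  congr _%:E; apply: eq_bigr => j _.
  have bj : fine (P2 (A `&` c2 @^-1` [set j])) <= p' j.
    rewrite fine_le ?fin_num_measure//; first exact: measurableI.
    by rewrite le_measure ?inE//; exact: measurableI.
  have b0 : 0 <= fine (P2 (A `&` c2 @^-1` [set j])) by rewrite fine_ge0.
  move: (fine _) bj b0 => b bj b0.
  transitivity (\sum_i m i j / p' j * b).
    apply: eq_bigr => i _; rewrite setTI -/(p i).
    have [pj0|pj0] := eqVneq (p' j) 0; first by rewrite m2_0// !mul0r.
    have [pi0|pi0] := eqVneq (p i) 0; first by rewrite m1_0// !mul0r.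
    by field; rewrite pj0 pi0.
  rewrite -!mulr_suml m2; have [pj0|pj0] := eqVneq (p' j) 0; last by rewrite divff// mul1r.
  by rewrite pj0 mul0r; rewrite pj0 in bj; lra.
have muT : mu setT = 1%E by rewrite -setXTT mu1// probability_setT.
(* Normalization supplies the structure of a probability; it changes nothing, as the total mass is
   already 1. *)
have nE S : mnormalize mu (P1 \x P2)%E S = mu S.
  by rewrite /mnormalize muT/= onee_eq0/= invr1 mule1.
exists (mnormalize mu (P1 \x P2)%E); split => [A mA|A mA|i j].
- exact: etrans (nE _) (mu1 _ mA).
- exact: etrans (nE _) (mu2 _ mA).
apply: etrans (nE _) _.
rewrite muX// (bigD1 i)//= (bigD1 j)//= !setIid -/(p i) -/(p' j).
rewrite big1 => [|j' jj']; last first.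
  rewrite [X in P2 X](_ : _ = set0) ?measure0 ?mulr0//.
  by apply/seteqP; split=> x //= [-> jj]; move: jj'; rewrite jj eqxx.
rewrite big1 => [|i' ii']; last first.
  rewrite big1// => j' _; rewrite [X in P1 X](_ : _ = set0) ?measure0 ?mul0r ?mulr0//.
  by apply/seteqP; split=> x //= [-> ii]; move: ii'; rewrite ii eqxx.
rewrite !addr0; congr _%:E.
have [pj0|pj0] := eqVneq (p' j) 0; first by rewrite m2_0// !mul0r.
have [pi0|pi0] := eqVneq (p i) 0; first by rewrite m1_0// !mul0r.
by field; rewrite pj0 pi0.
Qed.

End StepCoupling.

(** * Gluing two metric spaces *)

Section Glue.
Context (R : realType) (X Y : pmetricType R).

(** The conditions under which cross distances extend the two metrics to the disjoint union: the
    triangle inequalities that involve both spaces, and positivity, which excludes a mere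
    pseudo-metric. *)
Record gluing := Gluing {
  cross :> X -> Y -> R;
  cross_gt0 : forall x y, 0 < cross x y;
  cross_left : forall x x' y, cross x y <= mdist x x' + cross x' y;
  cross_right : forall x y y', cross x y <= cross x y' + mdist y' y;
  left_cross : forall x x' y, mdist x x' <= cross x y + cross x' y;
  right_cross : forall x y y', mdist y y' <= cross x y + cross x y' }.

(** The type carries [D] so that the metric attached to it can depend on [D]. *)
Definition glued (D : gluing) : Type := (X + Y)%type.

Variable D : gluing.

HB.instance Definition _ := Choice.on (glued D).

Definition glued_dist (u v : glued D) : R :=
  match u, v with
  | inl x, inl x' => mdist x x'
  | inr y, inr y' => mdist y y'
  | inl x, inr y | inr y, inl x => D x y
  end.

Let glued_distxx u : glued_dist u u = 0.
Proof. by case: u => a /=; rewrite mdistxx. Qed.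

Let glued_dist_eq0 u v : glued_dist u v = 0 -> u = v.
Proof.
case: u v => [x|y] [x'|y'] //=; first by move=> /mdist_positivity ->.
- by move=> D0; have := cross_gt0 D x y'; rewrite D0 ltxx.
- by move=> D0; have := cross_gt0 D x' y; rewrite D0 ltxx.
- by move=> /mdist_positivity ->.
Qed.

Let glued_dist_sym u v : glued_dist u v = glued_dist v u.
Proof. by case: u v => [x|y] [x'|y'] //=; rewrite metric_sym. Qed.

Let glued_dist_triangle v u w : glued_dist u w <= glued_dist u v + glued_dist v w.
Proof.
case: u v w => [x|y] [x'|y'] [x''|y''] //=; try exact: metric_triangle.
- exact: cross_left.
- exact: left_cross.
- exact: cross_right.
- by rewrite addrC (metric_sym x' x''); exact: cross_left.
- exact: right_cross.
- by rewrite addrC (metric_sym y y'); exact: cross_right.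
Qed.

HB.instance Definition _ := isMetric.Build R (glued D)
  glued_distxx glued_dist_eq0 glued_dist_sym glued_dist_triangle.

HB.instance Definition _ := isPointed.Build (glued D) (inl point).

Definition glued_inl : isoEmb X (glued D) :=
  @IsoEmb R X (glued D) (inl : X -> glued D) (fun _ _ => erefl).

Definition glued_inr : isoEmb Y (glued D) :=
  @IsoEmb R Y (glued D) (inr : Y -> glued D) (fun _ _ => erefl).

End Glue.

Lemma isoEmb_continuous (R : realType) (X Z : pmetricType R) (f : isoEmb X Z) : continuous f.
Proof.
move=> x; apply/cvg_ballP => e e0; apply: filterS (nbhsx_ballx x e e0) => x'.
by rewrite !ballEmdist/= iso_funP.
Qed.

Lemma glued_compact (R : realType) (X Y : pmetricType R) (D : gluing X Y) :
  compact [set: X] -> compact [set: Y] -> compact [set: glued D].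
Proof.
move=> cX cY.
pose F b := if b then glued_inl D @` setT else glued_inr D @` setT.
rewrite (_ : setT = \big[setU/set0]_(b <- [:: true; false]) F b).
  apply: bigsetU_compact => -[] _; apply: continuous_compact => //;
    by apply: continuous_subspaceT => ?; exact: isoEmb_continuous.
rewrite !big_cons big_nil setU0; apply/seteqP; split => // -[a|b] _.
  by left; exists a.
by right; exists b.
Qed.

(** The two inclusions push [th] forward to a coupling on the glued space, where [S] lands in the
    set of pairs at distance at most [r]. *)
Lemma dGHP_glue_le (R : realType) (X Y : mmSpace R) (D : gluing X Y)
    (th : probability (borel X * borel Y)%type R) (r : R) (S : set (borel X * borel Y)) :
  (forall A, measurable A -> th (A `*` setT) = mm_mu X A) ->
  (forall A, measurable A -> th (setT `*` A) = mm_mu Y A) ->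
  0 < r -> measurable S -> (forall z, S z -> D z.1 z.2 <= r) ->
  ((1 - r)%:E <= th S)%E -> (dGHP X Y <= r%:E)%E.
Proof.
move=> thX thY r0 mS SD thS.
pose Z : pmetricType R := glued D.
have cZ : compact [set: Z] by apply: glued_compact; exact: mm_compact.
pose h (z : borel X * borel Y) : borel Z * borel Z := (glued_inl D z.1, glued_inr D z.2).
have mh : measurable_fun setT h.
  apply/measurable_fun_pair => /=.
    exact: (measurableT_comp (@isoEmb_measurable _ _ _ (glued_inl D)) measurable_fst).
  exact: (measurableT_comp (@isoEmb_measurable _ _ _ (glued_inr D)) measurable_snd).
pose H : {mfun _ >-> _} := mfun_Sub (mem_set mh).
apply: (@le_trans _ _ (dP (distribution (mm_mu X) (glued_inl D))
  (distribution (mm_mu Y) (glued_inr D)) (fun z1 z2 : borel Z => mdist (z1 : Z) (z2 : Z)))).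
  by apply: ereal_inf_lbound; exists Z, (glued_inl D), (glued_inr D).
apply: (@dP_le _ _ _ _ _ _ (distribution th H)) => //.
  move=> A mA; split.
    rewrite -[LHS]/(th (h @^-1` (A `*` setT))) -[RHS]/(mm_mu X (glued_inl D @^-1` A)) -thX.
      by congr (th _); apply/seteqP; split => z //= [].
    by rewrite -[X in measurable X]setTI; exact: (@isoEmb_measurable _ _ _ (glued_inl D)).
  rewrite -[LHS]/(th (h @^-1` (setT `*` A))) -[RHS]/(mm_mu Y (glued_inr D @^-1` A)) -thY.
    by congr (th _); apply/seteqP; split => z //= [].
  by rewrite -[X in measurable X]setTI; exact: (@isoEmb_measurable _ _ _ (glued_inr D)).
apply: le_trans thS _.
rewrite -[leRHS]/(th (h @^-1` [set z | mdist (z.1 : Z) (z.2 : Z) <= r])).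
rewrite le_measure ?inE//.
rewrite -[X in measurable X]setTI; apply: (mh measurableT).
exact: (@measurable_mdist_le R (MMSpace cZ (distribution (mm_mu X) (glued_inl D)))).
Qed.

(** * Gluing along finitely many pairs of points *)

Section GluePairs.
Context (R : realType) (X Y : pmetricType R) (I : finType) (K : pred I) (i0 : I).
Context (x : I -> X) (y : I -> Y) (s : R).
Hypothesis Ki0 : K i0.
Hypothesis s0 : 0 < s.
Hypothesis xy : forall i j, K i -> K j -> `|mdist (x i) (x j) - mdist (y i) (y j)| <= 2 * s.

Let F a b i := mdist a (x i) + s + mdist (y i) b.

(** Length of a shortest path from [a] to [b] over one of the bridges of length [s] that join [x i]
    to [y i] for [i] in [K]. *)
Definition pair_dist a b : R := F a b [arg min_(i < i0 | K i) F a b i]%O.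

Lemma pair_dist_le a b i : K i -> pair_dist a b <= F a b i.
Proof. by rewrite /pair_dist; case: arg_minP => // j _; apply. Qed.

Lemma pair_dist_ex a b : exists2 i, K i & pair_dist a b = F a b i.
Proof. by rewrite /pair_dist; case: arg_minP => // j Kj _; exists j. Qed.

Let pair_dist_gt0 a b : 0 < pair_dist a b.
Proof.
by have [i _ ->] := pair_dist_ex a b; rewrite /F ltr_wpDr ?mdist_ge0// ltr_wpDl ?mdist_ge0.
Qed.

Let pair_dist_left a a' b : pair_dist a b <= mdist a a' + pair_dist a' b.
Proof.
have [i Ki ->] := pair_dist_ex a' b; apply: le_trans (pair_dist_le _ _ Ki) _.
by rewrite /F !addrA lerD2r lerD2r metric_triangle.
Qed.

Let pair_dist_right a b b' : pair_dist a b <= pair_dist a b' + mdist b' b.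
Proof.
have [i Ki ->] := pair_dist_ex a b'; apply: le_trans (pair_dist_le _ _ Ki) _.
by rewrite /F -!addrA !lerD2l metric_triangle.
Qed.

(** A path from [a] to [a'] through [b] crosses two bridges, [i] and [j]. Their total length [2 * s]
    makes up for the amount by which [y i] and [y j] may be closer than [x i] and [x j]. *)
Let left_pair_dist a a' b : mdist a a' <= pair_dist a b + pair_dist a' b.
Proof.
have [i Ki ->] := pair_dist_ex a b; have [j Kj ->] := pair_dist_ex a' b; rewrite /F.
have := xy Ki Kj; rewrite ler_norml => /andP[_ h].
have h1 := metric_triangle a (x i) a'; have h2 := metric_triangle (x i) (x j) a'.
have h3 := metric_triangle (y i) b (y j).
rewrite (metric_sym (x j) a') in h2; rewrite (metric_sym b (y j)) in h3.
lra.
Qed.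

Let right_pair_dist a b b' : mdist b b' <= pair_dist a b + pair_dist a b'.
Proof.
have [i Ki ->] := pair_dist_ex a b; have [j Kj ->] := pair_dist_ex a b'; rewrite /F.
have := xy Ki Kj; rewrite ler_norml => /andP[h _].
have h1 := metric_triangle b (y i) b'; have h2 := metric_triangle (y i) (y j) b'.
have h3 := metric_triangle (x i) a (x j).
rewrite (metric_sym b (y i)) in h1; rewrite (metric_sym (x i) a) in h3.
lra.
Qed.

Definition pair_gluing := Gluing pair_dist_gt0 pair_dist_left pair_dist_right
  left_pair_dist right_pair_dist.

End GluePairs.

(** * The lower bound *)

(** Used to turn a finite cover into a Borel partition, by the first set that contains a point. *)
Lemma measurable_find d (T : measurableType d) (U : eqType) (f : U -> set T) (s : seq U) k :
  (forall u, measurable (f u)) ->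
  measurable [set z | find (fun u => `[< f u z >]) s = k].
Proof.
move=> mf; elim: s k => [|u s IHs] k /=.
  have [->|k0] := eqVneq k 0%N.
    by rewrite (_ : [set _ | _] = setT)//; apply/seteqP; split.
  rewrite (_ : [set _ | _] = set0)//; apply/seteqP; split => //= z k0'.
  by rewrite -k0' eqxx in k0.
case: k => [|k].
  rewrite (_ : [set _ | _] = f u)//; apply/seteqP; split => z /=; first by case: asboolP.
  by move=> fz; rewrite asboolT.
rewrite (_ : [set _ | _] = ~` f u `&` [set z | find (fun u => `[< f u z >]) s = k]).
  by apply: measurableI; [exact: measurableC|exact: IHs].
apply/seteqP; split => z /=; first by case: asboolP => // fz [].
by move=> [fz <-]; rewrite asboolF.
Qed.

(** Compactness gives a finite cover by interiors of balls of radius [delta / 2]; the cell of a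
    point is the index of the first one containing it. *)
Lemma finite_cells (R : realType) (Z : pmetricType R) (delta : R) :
  compact [set: Z] -> 0 < delta ->
  exists (I : finType) (cell : borel Z -> I), (forall i, measurable (cell @^-1` [set i])) /\
    forall z z' : Z, cell z = cell z' -> mdist z z' < delta.
Proof.
rewrite compact_cover => cZ delta0.
pose f (z : Z) : set (borel Z) := (ball z (delta / 2))°.
have d20 : 0 < delta / 2 by rewrite divr_gt0.
have [||s _ sZ] := cZ Z setT f.
- by move=> z _; exact: open_interior.
- by move=> z _; exists z => //; exact: nbhsx_ballx.
pose idx (z : borel Z) := find (fun c => `[< f c z >]) (finmap.enum_fset s).
have idx_lt z : (idx z < size (finmap.enum_fset s))%N.
  rewrite -has_find; have [c /= cs fc] := sZ z I; apply/hasP; exists c => //; exact/asboolP.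
exists 'I_(size (finmap.enum_fset s)), (fun z => Ordinal (idx_lt z)); split => [i|z z' [zz']].
  rewrite (_ : _ @^-1` _ = [set z | idx z = i]).
    by apply: measurable_find => c; apply: sub_sigma_algebra; exact: open_interior.
  apply/seteqP; split => z /=; first by move=> <-.
  by move=> zi; apply/val_inj.
have near_idx u : mdist (nth point (finmap.enum_fset s) (idx u)) u < delta / 2.
  have : has (fun c => `[< f c u >]) (finmap.enum_fset s) by rewrite has_find; exact: idx_lt.
  by move=> /(nth_find point)/asboolP/interior_subset; rewrite ballEmdist.
have := near_idx z; have := near_idx z'; rewrite -zz'; set c := nth _ _ _ => cz' cz.
have := metric_triangle z c z'; rewrite (metric_sym z c); lra.
Qed.

Lemma measure_bigcup_finType_le d (T : measurableType d) (R : realType)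
    (mu : {measure set T -> \bar R}) (I : finType) (B : I -> set T) :
  (forall i, measurable (B i)) ->
  (mu (\bigcup_(i in [set: I]) B i) <= \sum_(i : I) mu (B i))%E.
Proof.
move=> mB; have := @content_sub_fsum _ _ _ mu I setT (\bigcup_(i in [set: I]) B i) B.
rewrite (fsbigE (index_enum I)) ?index_enum_uniq//=; last first.
  by move=> i _; rewrite mem_index_enum.
under eq_bigl do rewrite in_setT.
apply => //; apply: fin_bigcup_measurable => //; exact: finite_finset.
Qed.

(** * Samples with typical cell frequencies *)

Section Frequencies.
Context d (T : measurableType d) (R : realType) (P : probability T R).
Context (I : finType) (cell : T -> I).
Hypothesis mcell : forall i, measurable (cell @^-1` [set i]).

(** Only upper bounds are imposed: they are what puts the rescaled counts below the cell masses. In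
    particular a typical sample never hits a cell of mass 0. *)
Definition typical (c : R) N : set (N.-tuple T) := [set x | forall i,
  hits R (cell @^-1` [set i]) x <= N%:R * (c * fine (P (cell @^-1` [set i])))].

Let atypical (c : R) N i : set (N.-tuple T) :=
  [set x | N%:R * (c * fine (P (cell @^-1` [set i]))) < hits R (cell @^-1` [set i]) x].

Let measurable_atypical c N i : measurable (@atypical c N i).
Proof.
rewrite -[X in measurable X]setTI.
rewrite (_ : @atypical c N i = hits R (cell @^-1` [set i]) @^-1`
  `]N%:R * (c * fine (P (cell @^-1` [set i]))), +oo[%classic).
  by apply: measurable_hits.
by apply/seteqP; split => x /=; rewrite in_itv/= andbT.
Qed.

Let typicalE c N : @typical c N = ~` \bigcup_(i in [set: I]) @atypical c N i.
Proof.
apply/seteqP; split => [x xt [i _]|x xt i] /=; first by rewrite /atypical/= ltNge xt.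
by rewrite leNgt; apply/negP => h; apply: xt; exists i.
Qed.

Let measurable_bigcup_atypical c N : measurable (\bigcup_(i in [set: I]) @atypical c N i).
Proof. by apply: fin_bigcup_measurable => // i _; exact: measurable_atypical. Qed.

Lemma measurable_typical c N : measurable (@typical c N).
Proof. by rewrite typicalE; apply: measurableC; exact: measurable_bigcup_atypical. Qed.

Lemma typical_near (c eta : R) : 1 < c -> 0 < eta ->
  \forall N \near \oo, ((1 - eta)%:E <= iid P N (@typical c N))%E.
Proof.
move=> c1 eta0; pose e := eta / #|I|.+1%:R.
have e0 : 0 < e by rewrite divr_gt0.
(* A union bound over the cells, each allowed the share [e] of [eta]. *)
have : \forall N \near \oo, forall i, (iid P N (@atypical c N i) <= e%:E)%E.
  by apply: filter_forall => i; apply: LLN_hits_gt.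
apply: filterS => N bad.
rewrite typicalE probability_setC; last exact: measurable_bigcup_atypical.
rewrite EFinB leeB//.
have le1 := measure_bigcup_finType_le (iid P N) (fun i => @measurable_atypical c N i).
apply: le_trans le1 _.
apply: (@le_trans _ _ (\sum_(i : I) e%:E)%E); first by apply: lee_sum => i _; exact: bad.
rewrite sumEFin lee_fin sumr_const -mulr_natr /e -mulrA ger_pMr// mulrC ler_pdivrMr// mul1r.
by rewrite ler_nat.
Qed.

End Frequencies.

(** Otherwise [S] would be covered by the events that the first point misses [A] or the second
    misses [B], of total mass at most [2 * eta < 1 - r]. *)
Lemma coupling_meet d (T : measurableType d) (R : realType) (P1 P2 : probability T R)
    (th : probability (T * T)%type R) (S : set (T * T)) (A B : set T) (r eta : R) :
  coupling P1 P2 th -> measurable S -> measurable A -> measurable B ->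
  ((1 - r)%:E <= th S)%E -> ((1 - eta)%:E <= P1 A)%E -> ((1 - eta)%:E <= P2 B)%E ->
  r + 2 * eta < 1 -> exists z, [/\ S z, A z.1 & B z.2].
Proof.
move=> cth mS mA mB thS PA PB reta; apply: contrapT => /forallNP none.
have : (th S <= th (~` A `*` setT) + th (setT `*` ~` B))%E.
  apply: le_trans (measureU2 _ _ _); [|by apply: measurableX => //; exact: measurableC..].
  rewrite le_measure ?inE//.
    by apply: measurableU; apply: measurableX => //; exact: measurableC.
  move=> z Sz; apply: contrapT => /not_orP[/= nA nB]; apply: (none z); split => //.
    by apply: contrapT => ?; apply: nA.
  by apply: contrapT => ?; apply: nB.
rewrite (cth _ (measurableC mA)).1 (cth _ (measurableC mB)).2.
rewrite !probability_setC//.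
move: PA PB thS.
rewrite -(fineK (fin_num_measure P1 _ mA)) -(fineK (fin_num_measure P2 _ mB)).
rewrite -(fineK (fin_num_measure th _ mS)) -!EFinB -EFinD !lee_fin.
move: (fine _) (fine _) (fine _) => a b c; lra.
Qed.

Section TypicalMatrices.
Context (R : realType) (X : mmSpace R).

(* The matrices of the samples in E need not form a Borel set; their open
   neighbourhood does. *)
Definition near_matrices N (E : set (N.-tuple (borel X))) (delta : R) : set (borel (distmx R N)) :=
  [set A | exists2 x, E x & (ball (mx_of_points (x : N.-tuple X)) delta)° (\val A)].

Lemma measurable_near_matrices N (E : set (N.-tuple (borel X))) delta :
  measurable (near_matrices E delta).
Proof.
apply: sub_sigma_algebra.
exists (\bigcup_(x in E) (ball (mx_of_points (x : N.-tuple X)) delta)°).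
  by apply: bigcup_open => x _; exact: open_interior.
by apply/seteqP; split.
Qed.

Lemma theta_near_matrices N (E : set (N.-tuple (borel X))) delta : measurable E -> 0 < delta ->
  (iid (mm_mu X) N E <= theta X N (near_matrices E delta))%E.
Proof.
move=> mE delta0.
rewrite -[leRHS]/(iid (mm_mu X) N (@distmx_of_points R X N @^-1` near_matrices E delta)).
rewrite le_measure ?inE//.
  rewrite -[X in measurable X]setTI; apply: measurable_distmx_of_points => //.
  exact: measurable_near_matrices.
by move=> x Ex; exists x => //=; exact: nbhsx_ballx.
Qed.

End TypicalMatrices.

Lemma sum_eq_op (R : realType) (J : finType) (b : J) : \sum_(j : J) (b == j)%:R = 1 :> R.
Proof. by rewrite (bigD1 b)//= eqxx big1 ?addr0// => j /negbTE; rewrite eq_sym => ->. Qed.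

Lemma hits_fiber d (T : measurableType d) (R : realType) (I : finType) (cell : T -> I) N
  (x : N.-tuple T) a :
  hits R (cell @^-1` [set a]) x = \sum_(i < N) (cell (tnth x i) == a)%:R.
Proof.
apply: eq_bigr => i _; rewrite indicE; congr (_%:R); congr nat_of_bool.
by apply/idP/eqP => [/set_mem//|?]; exact/mem_set.
Qed.

(** * From matching samples to a coupling of the two spaces *)

Section Samples.
Context (R : realType) (X Y : mmSpace R) (delta e : R) (I J : finType).
Context (cX : borel X -> I) (cY : borel Y -> J).
Hypotheses (delta0 : 0 < delta) (e0 : 0 < e) (e1 : e < 1).
Hypothesis mcX : forall i, measurable (cX @^-1` [set i]).
Hypothesis mcY : forall j, measurable (cY @^-1` [set j]).
Hypothesis cX_small : forall z z' : X, cX z = cX z' -> mdist z z' < delta.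
Hypothesis cY_small : forall z z' : Y, cY z = cY z' -> mdist z z' < delta.
Context (N : nat) (x : N.-tuple (borel X)) (y : N.-tuple (borel Y)) (lam : {set 'I_N}).
Hypothesis xt : typical (mm_mu X) cX (1 + delta) x.
Hypothesis yt : typical (mm_mu Y) cY (1 + delta) y.
Hypothesis N0 : (0 < N)%N.
Hypothesis lamN : #|lam|%:R < N%:R * e.
Hypothesis xy : forall i j, i \notin lam -> j \notin lam ->
  `|mdist (tnth x i : X) (tnth x j) - mdist (tnth y i : Y) (tnth y j)| <= e + 2 * delta.

Let M := N%:R * (1 + delta).

Let M0 : 0 < M. Proof. by rewrite mulr_gt0 ?ltr0n// addr_gt0. Qed.

(** The empirical law of the pairs of cells over the kept indices, divided by [1 + delta] so that
    typicality bounds its marginals by the cell masses. *)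
Let q a b : R := (\sum_(i | i \notin lam)
  (cX (tnth x i) == a)%:R * (cY (tnth y i) == b)%:R) / M.

Let qX a : \sum_b q a b <= fine (mm_mu X (cX @^-1` [set a])).
Proof.
rewrite -mulr_suml exchange_big/= ler_pdivrMr//.
under eq_bigr do rewrite -mulr_sumr sum_eq_op mulr1.
rewrite mulrC /M -mulrA; apply: le_trans (xt a).
by rewrite hits_fiber [leRHS](bigID (fun i => i \in lam))/= lerDr sumr_ge0.
Qed.

Let qY b : \sum_a q a b <= fine (mm_mu Y (cY @^-1` [set b])).
Proof.
rewrite -mulr_suml exchange_big/= ler_pdivrMr//.
under eq_bigr do rewrite -mulr_suml sum_eq_op mul1r.
rewrite mulrC /M -mulrA; apply: le_trans (yt b).
by rewrite hits_fiber [leRHS](bigID (fun i => i \in lam))/= lerDr sumr_ge0.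
Qed.

Let lam_le : (#|lam| <= N)%N. Proof. exact: leq_trans (max_card _) (eq_leq (card_ord N)). Qed.

Let q_total : \sum_a \sum_b q a b = (N - #|lam|)%:R / M.
Proof.
under eq_bigr do rewrite -mulr_suml; rewrite -mulr_suml; congr (_ / _).
under eq_bigr do rewrite exchange_big/=; rewrite exchange_big/=.
under eq_bigr => i _ do under eq_bigr => a _ do rewrite -mulr_sumr sum_eq_op mulr1.
under eq_bigr do rewrite sum_eq_op.
rewrite sumr_const; congr (_ *+ _).
apply/eqP; rewrite -(eqn_add2l #|lam|) subnKC//; apply/eqP.
by apply: etrans (etrans (cardC lam) (card_ord N)); congr (_ + _)%N; exact: eq_card.
Qed.

(** Distance: a bridge of length [e / 2 + delta] and one cell diameter at each end. Mass: the kept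
    pairs retain at least [(1 - e) / (1 + delta)], which is at least [1 - (e + 3 * delta)]. *)
Lemma dGHP_of_samples : (dGHP X Y <= (e + 3 * delta)%:E)%E.
Proof.
have Nr : 0 < N%:R :> R by rewrite ltr0n.
(* The gluing needs at least one bridge; [e < 1] provides it. *)
have [i0 i0lam] : exists i0, i0 \notin lam.
  apply: contrapT => /forallNP lamT; move: lamN; rewrite ltNge => /negP; apply.
  rewrite (_ : #|lam| = N); first by rewrite ler_piMr ?ler0n// ltW.
  rewrite -[RHS]card_ord; apply: eq_card => i; rewrite inE; apply/negPn/negP; exact: lamT.
have q_lt1 : \sum_a \sum_b q a b < 1.
  rewrite q_total ltr_pdivrMr// mul1r (@le_lt_trans _ _ N%:R)//.
    by rewrite ler_nat leq_subr.
  by rewrite ltr_pMr// ltrDl.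
have pX : \sum_a fine (mm_mu X (cX @^-1` [set a])) = 1.
  apply: EFin_inj; rewrite -sumEFin -(probability_setT (mm_mu X)) (measure_cells mcX)//.
  by apply: eq_bigr => a _; rewrite setTI fineK// fin_num_measure.
have pY : \sum_b fine (mm_mu Y (cY @^-1` [set b])) = 1.
  apply: EFin_inj; rewrite -sumEFin -(probability_setT (mm_mu Y)) (measure_cells mcY)//.
  by apply: eq_bigr => a _; rewrite setTI fineK// fin_num_measure.
have [m [qm mX mY]] := subcoupling_extend qX qY pX pY q_lt1.
have q0 a b : 0 <= q a b by rewrite divr_ge0 ?(ltW M0)// sumr_ge0.
have m0 a b : 0 <= m a b by apply: le_trans (qm a b).
have [th [thX thY thm]] := step_coupling mcX mcY m0 mX mY.
have s0 : 0 < e / 2 + delta by rewrite addr_gt0// divr_gt0.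
have xy' i j : i \notin lam -> j \notin lam ->
    `|mdist (tnth x i : X) (tnth x j) - mdist (tnth y i : Y) (tnth y j)| <= 2 * (e / 2 + delta).
  by move=> il jl; rewrite (le_trans (xy il jl))//; lra.
pose D := @pair_gluing R X Y 'I_N (fun i => i \notin lam) i0 (tnth x) (tnth y) _ i0lam s0 xy'.
pose cell (z : borel X * borel Y) := (cX z.1, cY z.2).
have cellE a b : cell @^-1` [set (a, b)] = (cX @^-1` [set a]) `*` (cY @^-1` [set b]).
  by apply/seteqP; split => -[u v]; rewrite /cell/=; [case=> -> ->|move=> [-> ->]].
have mcell ab : measurable (cell @^-1` [set ab]).
  by case: ab => a b; rewrite cellE; exact: measurableX.
(* All pairs of points lying in the same pair of cells as some kept sample pair. *)
pose S := \bigcup_(i in [set i | i \notin lam]) cell @^-1` [set cell (tnth x i, tnth y i)].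
apply: (@dGHP_glue_le _ _ _ D th _ S) => //.
- by rewrite addr_gt0// mulr_gt0.
- by apply: fin_bigcup_measurable => //; exact: finite_finset.
- move=> [u v] [i il] [uX vY] /=.
  have Duv : D u v <= mdist (u : X) (tnth x i) + (e / 2 + delta) + mdist (tnth y i : Y) v.
    exact: (@pair_dist_le _ _ _ _ (fun i => i \notin lam)).
  have h1 : mdist (u : X) (tnth x i) < delta by exact: cX_small.
  have h2 : mdist (tnth y i : Y) v < delta by apply: cY_small.
  have h : delta + (e / 2 + delta) + delta <= e + 3 * delta by move: delta0 e0; lra.
  by apply: le_trans Duv (le_trans _ h); rewrite lerD ?lerD2r ?ltW.
apply: (@le_trans _ _ (\sum_(ab : I * J) (q ab.1 ab.2)%:E)%E).
  rewrite sumEFin -(pair_bigA _ q)/= q_total lee_fin ler_pdivlMr//.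
  rewrite natrB// /M; move: lamN; move: (#|lam|%:R) => l ll.
  (* Indeed [(1 - e - 3 * delta) * (1 + delta) = 1 - e - delta * (2 + e + 3 * delta)]. *)
  have : 0 <= N%:R * (delta * (2 + e + 3 * delta)).
    by rewrite !mulr_ge0// ?ler0n ?(ltW delta0)//; move: delta0 e0; lra.
  lra.
rewrite (measure_cells mcell); last first.
  by apply: fin_bigcup_measurable => //; exact: finite_finset.
apply: lee_sum => -[a b] _ /=.
(* A pair of cells hit by a kept sample pair lies wholly in [S] and has mass [m a b >= q a b]; for
   any other pair [q a b = 0]. *)
have [[i [il ia ib]]|none] := pselect (exists i,
    [/\ i \notin lam, cX (tnth x i) = a & cY (tnth y i) = b]).
  rewrite (_ : S `&` _ = cell @^-1` [set (a, b)]); first by rewrite cellE thm lee_fin.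
  by apply/seteqP; split => [z []//|z /= zab]; split => //; exists i => //=; rewrite /cell/= ia ib.
rewrite [X in X%:E](_ : _ = 0) ?measure_ge0// /q big1 ?mul0r// => i il.
have [ia|] := eqVneq (cX (tnth x i)) a; last by rewrite mul0r.
have [ib|] := eqVneq (cY (tnth y i)) b; last by rewrite mulr0.
by exfalso; apply: none; exists i.
Qed.

End Samples.

Lemma limn_einf_lt (R : realType) (u : (\bar R)^nat) (c : \bar R) (n0 : nat) :
  (limn_einf u < c)%E -> exists2 n, (n0 <= n)%N & (u n < c)%E.
Proof.
move=> uc; apply: contrapT => /forall2NP none; move: uc; apply/negP; rewrite -leNgt.
rewrite /limn_einf leeNr; apply: limn_esup_le.
exists n0 => // n /= n0n; rewrite leeN2 leNgt; apply/negP.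
by have [/(_ n0n)|] := none n.
Qed.

Lemma dGHP_lt_of_liminf (R : realType) (X Y : mmSpace R) (eps : R) :
  (limn_einf (fun N => dP (theta X N) (theta Y N) (@dpi_distmx R N)) < eps%:E)%E ->
  eps < 1 -> (dGHP X Y < eps%:E)%E.
Proof.
move=> lim_eps eps1.
have [e lim_e e_eps] : exists2 e : R,
    (limn_einf (fun N => dP (theta X N) (theta Y N) (@dpi_distmx R N)) < e%:E)%E & e < eps.
  case: (limn_einf _) lim_eps => [l| //|].
  - rewrite lte_fin => l_eps; exists ((l + eps) / 2); rewrite ?lte_fin; lra.
  - by move=> _; exists (eps - 1); [exact: ltNyr|lra].
(* A quarter leaves [e + 3 * delta < eps], whence the strict conclusion; below, a third of [1 - e]
   leaves [r + 2 * eta < 1] for every [r < e]. *)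
pose delta := (eps - e) / 4; have delta0 : 0 < delta by rewrite divr_gt0// subr_gt0.
pose eta := (1 - e) / 3; have eta0 : 0 < eta by rewrite divr_gt0//; lra.
have [I [cX [mcX cX_small]]] := finite_cells (@mm_compact _ X) delta0.
have [J [cY [mcY cY_small]]] := finite_cells (@mm_compact _ Y) delta0.
have c1 : 1 < 1 + delta by rewrite ltrDl.
have [nX _ tX] := typical_near (mm_mu X) mcX c1 eta0.
have [nY _ tY] := typical_near (mm_mu Y) mcY c1 eta0.
have [N] := limn_einf_lt (maxn 1 (maxn nX nY)) lim_e.
rewrite !geq_max => /and3P[N0 nXN nYN] /dP_ltP[th [r [cth r0]]]; rewrite lte_fin => re thr.
have mS := measurable_dpi_le r N0.
set GX := typical (mm_mu X) cX (1 + delta) (N := N).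
set GY := typical (mm_mu Y) cY (1 + delta) (N := N).
have pA : ((1 - eta)%:E <= theta X N (near_matrices GX delta))%E.
  by apply: le_trans (theta_near_matrices _ delta0); [exact: tX|exact: measurable_typical].
have pB : ((1 - eta)%:E <= theta Y N (near_matrices GY delta))%E.
  by apply: le_trans (theta_near_matrices _ delta0); [exact: tY|exact: measurable_typical].
have [] := coupling_meet cth mS (measurable_near_matrices _ _)
    (measurable_near_matrices _ _) thr pA pB.
  by rewrite /eta; lra.
(* [A] and [B] are only [delta]-close to matrices of typical samples [x] and [y], which adds
   [2 * delta] to the entrywise bound [e]. *)
move=> [A B] /= [AB [x xt /interior_subset xA] [y yt /interior_subset yB]].
have [s] := dpi_ltP (le_lt_trans AB re).
move=> /(dM_ltP N0)[lam lamN ABe].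
(* Reordering [y] absorbs the permutation; typicality depends only on the cell counts, so it
   survives. *)
pose y' : N.-tuple (borel Y) := [tuple tnth y (s i) | i < N].
have y't : typical (mm_mu Y) cY (1 + delta) y'.
  move=> j; have := yt j; rewrite !hits_fiber (reindex_inj (@perm_inj _ s))/=.
  by under [in X in _ -> X]eq_bigr do rewrite tnth_mktuple.
apply: le_lt_trans (dGHP_of_samples delta0 (lt_trans r0 re) _ mcX mcY cX_small cY_small xt y't
  N0 lamN _) _.
- exact: lt_trans eps1.
- move=> i j il jl; rewrite !tnth_mktuple.
  have [_ /(_ i j)] := xA; have [_ /(_ (s i) (s j))] := yB.
  have := ABe i j il jl; rewrite permute_mxE /ball/= !mxE.
  rewrite ltr_norml => /andP[h1 h2]; rewrite ltr_norml => /andP[h3 h4].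
  rewrite ltr_norml => /andP[h5 h6].
  by rewrite ler_norml; apply/andP; split; lra.
- by rewrite lte_fin /delta; lra.
Qed.

Theorem theorem6p1 (R : realType) (X Y : mmSpace R) :
  (limn_esup (fun N => dP (theta X N) (theta Y N) (@dpi_distmx R N))
     <= 2%:E * dGHP X Y)%E /\
  (forall eps : R,
     (limn_einf (fun N => dP (theta X N) (theta Y N) (@dpi_distmx R N))
        < eps%:E)%E ->
     eps < 1 ->
     (dGHP X Y < eps%:E)%E).
Proof.
split; first exact: limn_esup_dP_theta_le.
by move=> eps; exact: dGHP_lt_of_liminf.
Qed.
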